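(* For each $m\ge1$ let $F_m:\mathbb{N}\to\mathbb{R}_{>0}$ be given with $F_m(0)=1$. Then, as formal power series in $t$, $$\sum_{n=0}^\infty t^nh_n(F)=\prod_{m=1}^\infty \mathrm{EG}\Big(F_m,\frac{t^m}{m}\Big).$$ If $b\in\mathbb{N}$ and $s_1,\dots,s_b\in\mathbb{R}$ are fixed, then $$\sum_{n=0}^\infty t^nh_n(F)\,\mathbb{E}_{\mathrm F}\Big[\exp\Big(i\sum_{m=1}^bs_mC_m^{(n)}\Big)\Big]=\prod_{m=1}^b\mathrm{EG}\Big(F_m,e^{is_m}\frac{t^m}{m}\Big)\prod_{m=b+1}^\infty\mathrm{EG}\Big(F_m,\frac{t^m}{m}\Big),$$ and for each $w\in\mathbb{C}$ $$\sum_{n=0}^\infty t^nh_n(F)\,\mathbb{E}_{\mathrm F}\big[\exp(wK_{0n})\big]=\prod_{m=1}^\infty\mathrm{EG}\Big(F_m,e^{w}\frac{t^m}{m}\Big).$$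
   Context: Here $\mathbb{N}=\{0,1,2,\dots\}$ as domain of $F_m$. For $\sigma$ in the symmetric group $S_n$, $C_m^{(n)}(\sigma)$ is the number of cycles of length $m$ in the disjoint cycle decomposition of $\sigma$ (zero if $m>n$), and $K_{0n}=\sum_{m=1}^nC_m^{(n)}$. The generalized weighted measure on $S_n$ is $\mathbb{P}_{\mathrm F}[\sigma]=\frac{1}{n!\,h_n(F)}\prod_{m=1}^nF_m(C_m^{(n)}(\sigma))$, where $h_n(F)=\frac1{n!}\sum_{\sigma\in S_n}\prod_{m=1}^nF_m(C_m^{(n)}(\sigma))$ is the normalization constant ($h_0(F)=1$, and the expectation for $n=0$ is $1$); $\mathbb{E}_{\mathrm F}$ is expectation under $\mathbb{P}_{\mathrm F}$. For $A:\mathbb{N}\to\mathbb{C}$, $\mathrm{EG}(A,t)=\sum_{k=0}^\infty\frac{A(k)}{k!}t^k$. *)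

(* Defs.v *)
From mathcomp Require Import all_boot all_order all_algebra all_fingroup.
From mathcomp Require Import all_classical all_reals all_analysis.
From mathcomp Require Export complex.

Set Implicit Arguments.
Unset Strict Implicit.
Unset Printing Implicit Defensive.

Import Order.TTheory GRing.Theory Num.Theory.
Local Open Scope ring_scope.
Local Open Scope complex_scope.

(* A formal power series is its sequence of coefficients. *)

Section FormalPowerSeries.
Variable K : fieldType.

Definition fps := nat -> K.

Definition fps1 : fps := fun n => (n == 0%N)%:R.

Definition fps_mul (f g : fps) : fps :=
  fun n => \sum_(i < n.+1) f i * g (n - i)%N.

(* c t^m *)
Definition fps_monom (c : K) (m : nat) : fps := fun n => c *+ (n == m).

Definition fps_exp (u : fps) (k : nat) : fps := iter k (fps_mul u) fps1.

(* \prod_(a <= m < b) f m *)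
Definition fps_prod (a b : nat) (f : nat -> fps) : fps :=
  \big[fps_mul/fps1]_(a <= m < b) f m.

(* P is the infinite product of the f m for m >= a: the partial products
   converge to P in the t-adic topology, i.e., every coefficient is eventually
   constant. *)
Definition fps_infprod (a : nat) (f : nat -> fps) (P : fps) : Prop :=
  forall n, exists N, forall M, (N <= M)%N -> fps_prod a M f n = P n.

(* EG(A, u) = \sum_k A(k)/k! u^k, for a series u without constant term. As u^k
   then has order at least k, only the terms k <= n contribute to t^n. *)
Definition EG (A : nat -> K) (u : fps) : fps :=
  fun n => \sum_(k < n.+1) A k / (k`!)%:R * fps_exp u k n.

End FormalPowerSeries.

Definition cexp (R : realType) (z : R[i]) : R[i] :=
  (expR (complex.Re z))%:C * (cos (complex.Im z) +i* sin (complex.Im z)).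

(* C_m^(n)(sigma); the orbits of sigma are its cycles, fixed points included *)
Definition ncycles (n : nat) (m : nat) (sigma : 'S_n) : nat :=
  #|[set c in porbits sigma | #|c| == m]|.

Definition K0 (n : nat) (sigma : 'S_n) : nat :=
  (\sum_(1 <= m < n.+1) ncycles m sigma)%N.

(* F m k stands for F_m(k); the values F 0 k are not used. *)
Section WeightedMeasure.
Variable R : realType.
Variable F : nat -> nat -> R.

Definition weight (n : nat) (sigma : 'S_n) : R :=
  \prod_(1 <= m < n.+1) F m (ncycles m sigma).

Definition h (n : nat) : R := (n`!%:R)^-1 * \sum_(sigma : 'S_n) weight sigma.

Definition PF (n : nat) (sigma : 'S_n) : R :=
  (n`!%:R * h n)^-1 * weight sigma.

Definition EF (n : nat) (X : 'S_n -> R[i]) : R[i] :=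
  \sum_(sigma : 'S_n) (PF sigma)%:C * X sigma.

End WeightedMeasure.

(* Main.v *)
(* Write [A_n(G)] for the coefficient of [t^n] in [prod_m EG(G_m, t^m/m)] and
   [W_n(G)] for the sum over [S_n] of [prod_m G_m(C_m(sigma))]. Then
   [W_n(G) = n! A_n(G)], as both sides satisfy the same recursion in [n], with
   [G] varying.

   A permutation of [n+1] points is obtained from one of [n] points by adding
   the new point either as a fixed point or right after an old point [j]. In the
   second case, the cycle of [j], of length [l], becomes a cycle of length
   [l+1], and a permutation has [l C_l] such points [j]. Thus, with [S] the shift
   [(S H)(k) = H(k+1)],
     W_(n+1)(G) = W_n(G, G_1 := S G_1)
       + sum_(l <= n) W_n(G, G_(l+1) := S G_(l+1), G_l(k) := l k G_l(k-1)).
   On the other side, [EG(k |-> m k H(k-1), t^m/m) = t^m EG(H, t^m/m)], so the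
   [l]-th term becomes [A_(n-l)(G, G_(l+1) := S G_(l+1))], and together
   with [A_n(G, G_1 := S G_1)] they add up to [(n+1) A_(n+1)(G)] by the Leibniz rule for [t d/dt].

   The three series are the cases [G_m(k) = F_m(k) u_m^k] for suitable [u]. *)

From HB Require Import structures.
Require Import Defs.
From mathcomp Require Import all_boot all_order all_algebra all_fingroup.
From mathcomp Require Import all_classical all_reals all_analysis.
(* [all_classical] shadows lemmas of [fintype] and [finset]. *)
From mathcomp Require Import fintype finset ring.

Set Implicit Arguments.
Unset Strict Implicit.
Unset Printing Implicit Defensive.

Import Order.TTheory GRing.Theory Num.Theory.
Local Open Scope ring_scope.
Local Open Scope complex_scope.

(** * Inserting a fixed point into another cycle *)

Lemma porbit_sub (T : finType) (u : {perm T}) (A : {set T}) y :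
  y \in A -> {in A, forall z, u z \in A} -> porbit u y \subset A.
Proof.
move=> yA uA; apply/subsetP => _ /porbitP[i ->].
by elim: i => [|i IH]; rewrite ?expg0 ?perm1 // expgSr permM uA.
Qed.

Lemma porbit_stable (T : finType) (u : {perm T}) y z : z \in porbit u y -> u z \in porbit u y.
Proof. by rewrite -!eq_porbit_mem => /eqP <-; rewrite (porbit_perm _ 1). Qed.

Section InsertPoint.
Variables (T : finType) (s : {perm T}) (a x : T).
Hypotheses (sa : s a = a) (xa : x != a).
Let t : {perm T} := (tperm a x * s)%g.

Lemma porbit_fix : porbit s a = [set a].
Proof.
apply/eqP; rewrite eqEsubset porbit_sub ?set11 //=; first by rewrite sub1set porbit_id.
by move=> z /set1P->; rewrite sa set11.
Qed.

Let ta : t a = s x. Proof. by rewrite permM tpermL. Qed.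
Let tx : t x = a. Proof. by rewrite permM tpermR. Qed.
Let tE z : z != a -> z != x -> t z = s z.
Proof. by move=> za zx; rewrite permM tpermD // eq_sym. Qed.

(** [t] sends [x] to [a] and [a] to [s x], so [a] comes right after [x]. For each inclusion, the
    larger set is stable under the permutation whose orbit is the smaller one. *)
Lemma porbit_insert : porbit t x = a |: porbit s x.
Proof.
have aO : a \in porbit t x by rewrite -tx porbit_stable ?porbit_id.
apply/eqP; rewrite eqEsubset; apply/andP; split.
  apply: porbit_sub => [|z]; first by rewrite !inE porbit_id orbT.
  have [-> _|zx] := eqVneq z x; first by rewrite tx setU11.
  have [-> _|za] := eqVneq z a.
    by rewrite ta inE porbit_stable ?orbT // porbit_id.
  by rewrite tE // !inE (negPf za) /= => /porbit_stable ->; rewrite orbT.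
rewrite subUset sub1set aO /=; apply: porbit_sub; first exact: porbit_id.
move=> z zO; have [->|za] := eqVneq z a; first by rewrite sa.
have [->|zx] := eqVneq z x; first by rewrite -ta porbit_stable.
by rewrite -tE // porbit_stable.
Qed.

Lemma porbit_insertD y : y != a -> y \notin porbit s x -> porbit t y = porbit s y.
Proof.
move=> ya yx.
have aP : a \notin porbit s y.
  by rewrite porbit_sym porbit_fix inE.
have xP : x \notin porbit s y by rewrite porbit_sym.
have tP z : z \in porbit s y -> t z = s z.
  by move=> zP; rewrite tE //; [apply: contraNneq aP | apply: contraNneq xP] => <-.
have tX i : (t ^+ i)%g y = (s ^+ i)%g y.
  elim: i => [|i IH]; first by rewrite !expg0.
  by rewrite !expgSr permM [RHS]permM IH tP // mem_porbit.
apply/setP => z.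
by apply/porbitP/porbitP => -[i ->]; exists i; rewrite tX.
Qed.

Lemma porbits_insert :
  porbits t = (a |: porbit s x) |: (porbits s :\ [set a] :\ porbit s x).
Proof.
apply/setP => c; rewrite !inE; apply/imsetP/orP.
  case=> y _ ->; have [yP|yP] := boolP (y \in a |: porbit s x).
    by left; rewrite -porbit_insert eq_porbit_mem porbit_insert.
  right; move: yP; rewrite !inE negb_or => /andP[ya yP].
  rewrite porbit_insertD // eq_porbit_mem yP /= imset_f // andbT.
  by rewrite -porbit_fix eq_porbit_mem porbit_fix inE.
case=> [/eqP->|]; first by exists x => //; rewrite porbit_insert.
case/and3P => cx ca /imsetP[y _ cE]; exists y => //.
rewrite porbit_insertD //; first by apply: contraNneq ca => E; rewrite cE E porbit_fix.
  by rewrite -eq_porbit_mem -cE.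
Qed.

End InsertPoint.

(** * Cycle counts *)

Section CycleCounts.
Variable n : nat.
Implicit Types (s : 'S_n) (m : nat).

Lemma ncyclesE m s : ncycles m s = (\sum_(c in porbits s) (#|c| == m))%N.
Proof.
rewrite /ncycles -sum1_card big_mkcond [RHS]big_mkcond; apply: eq_bigr => c _.
by rewrite !inE; case: (c \in _) => //=; case: eqP.
Qed.

Lemma ncycles_gt m s : (n < m)%N -> ncycles m s = 0%N.
Proof.
move=> nm; rewrite ncyclesE big1 // => c _; apply/eqP; rewrite eqb0.
by rewrite ltn_eqF // (leq_ltn_trans _ nm) // -[X in (_ <= X)%N]card_ord max_card.
Qed.

(** Group the points by their cycle: each cycle of length [m] collects [m] of them. *)
Lemma card_porbit_eq m s :
  #|[set j | #|porbit s j| == m]| = (m * ncycles m s)%N.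
Proof.
rewrite -[RHS]mulnC -sum1_card (partition_big (porbit s)
  (mem [set c in porbits s | #|c| == m])) /=; last first.
  by move=> j; rewrite !inE => ->; rewrite andbT imset_f.
rewrite -sum_nat_const; apply: eq_bigr => c; rewrite inE.
case/andP=> /imsetP[j _ ->] /eqP <-; rewrite sum1dep_card; apply: eq_card => k.
by rewrite !inE eq_porbit_mem; apply: andb_idl; rewrite -eq_porbit_mem => /eqP->.
Qed.

End CycleCounts.

(** * Permutations of n+1 points from permutations of n points *)

Section InsertOrd.
Variable n : nat.
Implicit Types (s : 'S_n) (m : nat).

Let up s : 'S_n.+1 := lift_perm ord0 ord0 s.

Lemma porbit_up s j : porbit (up s) (lift ord0 j) = lift ord0 @: porbit s j.
Proof.
have upX i : (up s ^+ i)%g (lift ord0 j) = lift ord0 ((s ^+ i)%g j).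
  elim: i => [|i IH]; first by rewrite !expg0 !perm1.
  by rewrite !expgSr !permM IH lift_perm_lift.
apply/setP=> k; apply/porbitP/imsetP=> [[i ->]|[l /porbitP[i ->] ->]].
  by exists ((s ^+ i)%g j); rewrite ?mem_porbit.
by exists i.
Qed.

Lemma porbit_up0 s : porbit (up s) ord0 = [set ord0].
Proof. by apply: porbit_fix; rewrite lift_perm_id. Qed.

Lemma porbits_up s :
  porbits (up s) = [set ord0] |: [set lift ord0 @: c | c : {set 'I_n} in porbits s].
Proof.
apply/setP => c; rewrite !inE; apply/imsetP/orP.
  case=> i _ ->; case: (unliftP ord0 i) => [j ->|->].
    by right; rewrite porbit_up; apply/imsetP; exists (porbit s j) => //; rewrite imset_f.
  by left; rewrite porbit_up0.
case=> [/eqP->|/imsetP[_ /imsetP[j _ ->] ->]]; first by exists ord0; rewrite ?porbit_up0.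
by exists (lift ord0 j); rewrite ?porbit_up.
Qed.

Lemma ncycles_up m s : ncycles m (up s) = ((m == 1) + ncycles m s)%N.
Proof.
rewrite !ncyclesE porbits_up big_setU1 /=; last first.
  apply/imsetP => -[c _ /setP/(_ ord0)]; rewrite set11 => /esym/imsetP[j _].
  by move/eqP; rewrite (negPf (neq_lift _ _)).
rewrite cards1 eq_sym big_imset /=; last first.
  by move=> c d _ _; apply: imset_inj; apply: lift_inj.
by congr addn; apply: eq_bigr => c _; rewrite card_imset //; apply: lift_inj.
Qed.

(** The new point is [ord0], the old ones are shifted by [lift ord0]. For [i = ord0] the
    transposition is trivial and the new point stays fixed; otherwise it goes right after [i]. *)
Definition ins_perm (i : 'I_n.+1) s : 'S_n.+1 := (tperm ord0 i * up s)%g.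

Lemma ncycles_ins0 m s : ncycles m (ins_perm ord0 s) = ((m == 1) + ncycles m s)%N.
Proof. by rewrite /ins_perm tperm1 mul1g ncycles_up. Qed.

(** A cycle of length [l] is lost and one of length [l.+1] gained; the loss is added on the left to
    avoid truncated subtraction. *)
Lemma ncycles_ins m s j (l := #|porbit s j|) :
  (ncycles m (ins_perm (lift ord0 j) s) + (m == l) = ncycles m s + (m == l.+1))%N.
Proof.
have cl : #|porbit (up s) (lift ord0 j)| = l.
  by rewrite porbit_up card_imset //; apply: lift_inj.
have j0 : lift ord0 j != ord0 by rewrite eq_sym neq_lift.
have up0 : up s ord0 = ord0 by rewrite lift_perm_id.
have n0 : ord0 \notin porbit (up s) (lift ord0 j).
  by rewrite porbit_sym porbit_up0 inE.
(* Adding [m == 1] on both sides accounts for the singleton cycle of [ord0] in [up s], which is the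
   one merged with the cycle of [j]. *)
apply/eqP; rewrite -(eqn_add2l (m == 1)) [X in _ == X]addnA -ncycles_up; apply/eqP.
rewrite !ncyclesE porbits_insert // big_setU1 /=; last first.
  rewrite !inE; apply/negP => /and3P[_ _ /imsetP[y _ yE]].
  have : ord0 \in porbit (up s) y by rewrite -yE setU11.
  rewrite -eq_porbit_mem => /eqP y0; move/setP: yE => /(_ (lift ord0 j)).
  by rewrite -y0 porbit_up0 !inE porbit_id (negPf j0).
rewrite [in RHS](big_setD1 [set ord0]) /=; last first.
  by rewrite -(porbit_up0 s) imset_f.
rewrite [in RHS](big_setD1 (porbit (up s) (lift ord0 j))) /=; last first.
  rewrite !inE imset_f // andbT; apply: contraNneq j0 => E.
  by rewrite -in_set1 -E porbit_id.
rewrite cardsU1 n0 cl cards1 (eq_sym 1%N) add1n (eq_sym l) (eq_sym l.+1).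
by rewrite -!addnA; congr addn; rewrite addnCA [RHS]addnCA; congr addn; exact: addnC.
Qed.

(** Insertion is injective between sets of equal size: [i] is the preimage of [ord0], and cancelling
    the transposition then recovers [s]. *)
Lemma sum_ins (V : nmodType) (phi : 'S_n.+1 -> V) :
  \sum_s phi s = \sum_(i : 'I_n.+1) \sum_s phi (ins_perm i s).
Proof.
rewrite pair_big /=.
pose f (p : 'I_n.+1 * 'S_n) := ins_perm p.1 p.2.
rewrite (reindex f) //=; apply: onW_bij; apply: inj_card_bij; last first.
  by rewrite card_prod card_Sn card_Sn card_ord.
have f0 p : f p p.1 = ord0 by rewrite permM tpermR lift_perm_id.
move=> [i s] [k u] E; have ik : i = k.
  by apply: (@perm_inj _ (f (i, s))); rewrite {2}E (f0 (i, s)) (f0 (k, u)).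
move: E; rewrite ik => /mulgI E; congr pair; apply/permP => j.
by apply: (@lift_inj _ ord0); rewrite -!(lift_perm_lift ord0 ord0) [lift_perm _ _ s]E.
Qed.

End InsertOrd.

(** * Algebra of formal power series and of [EG] at monomials *)

Section FpsRing.
Variable K : fieldType.
Implicit Types (f g h : fps K) (c d : K) (A : nat -> K).

(** Truncation to polynomials: the coefficients of a product up to [N] depend only on those of the
    factors up to [N], so the laws of [fps_mul] come from [{poly K}]. *)
Let tr N f : {poly K} := \poly_(i < N.+1) f i.

Let coef_tr N f i : (i <= N)%N -> (tr N f)`_i = f i.
Proof. by move=> iN; rewrite coef_poly ltnS iN. Qed.

Let fps_mul_tr N f g i : (i <= N)%N -> fps_mul f g i = (tr N f * tr N g)`_i.
Proof.
move=> iN; rewrite coefM; apply: eq_bigr => j _.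
by rewrite !coef_tr ?(leq_trans _ iN) ?leq_subr // -ltnS.
Qed.

Lemma fps_mulC : commutative (@fps_mul K).
Proof. by move=> f g; apply/funext => n; rewrite !(@fps_mul_tr n) // mulrC. Qed.

Lemma fps_mulA : associative (@fps_mul K).
Proof.
move=> f g h; apply/funext => n.
have congM (p q r : {poly K}) : (forall i, (i <= n)%N -> p`_i = q`_i) ->
    (p * r)`_n = (q * r)`_n.
  by move=> pq; rewrite !coefM; apply: eq_bigr => i _; rewrite pq // -ltnS.
have trM u v i : (i <= n)%N -> (tr n (fps_mul u v))`_i = (tr n u * tr n v)`_i.
  by move=> iN; rewrite coef_tr // (@fps_mul_tr n).
rewrite !(@fps_mul_tr n) // (mulrC (tr n f)).
rewrite (congM (tr n (fps_mul g h)) (tr n g * tr n h)); last exact: trM.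
rewrite (congM (tr n (fps_mul f g)) (tr n f * tr n g)); last exact: trM.
by rewrite mulrC mulrA.
Qed.

Lemma fps_mul1 : left_id (@fps1 K) (@fps_mul K).
Proof.
move=> f; apply/funext => n; rewrite /fps_mul big_ord_recl big1 ?addr0.
  by rewrite /fps1 mul1r subn0.
by move=> i _; rewrite /fps1 mul0r.
Qed.

HB.instance Definition _ :=
  Monoid.isComLaw.Build (fps K) (@fps1 K) (@fps_mul K) fps_mulA fps_mulC fps_mul1.

Lemma fps_mul_eq f f' g g' n :
  (forall i, (i <= n)%N -> f i = f' i) -> (forall i, (i <= n)%N -> g i = g' i) ->
  fps_mul f g n = fps_mul f' g' n.
Proof.
move=> ff gg; apply: eq_bigr => i _.
by rewrite ff ?gg ?leq_subr // -ltnS.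
Qed.

Lemma fps_mul_monom c m f n :
  fps_mul (fps_monom c m) f n = if (m <= n)%N then c * f (n - m)%N else 0.
Proof.
rewrite /fps_mul /fps_monom; case: ifP => mn.
  rewrite (bigD1 (inord m)) //= inordK // eqxx mulr1n big1 ?addr0 // => i im.
  rewrite (_ : (i == m :> nat) = false) ?mulr0n ?mul0r //.
  by apply: contraNF im => /eqP im; apply/eqP/val_inj; rewrite /= inordK.
rewrite big1 // => i _; rewrite (_ : (i == m :> nat) = false) ?mulr0n ?mul0r //.
by apply: contraFF mn => /eqP <-; rewrite -ltnS.
Qed.

Lemma fps_exp_monom c m k : fps_exp (fps_monom c m) k = fps_monom (c ^+ k) (m * k).
Proof.
elim: k => [|k IH]; first by rewrite muln0 expr0.
rewrite /fps_exp iterS -/(fps_exp _ _) IH; apply/funext => n.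
rewrite fps_mul_monom /fps_monom mulnS exprS; case: ifP => mn.
  by rewrite mulrnAr; congr (_ *+ _); rewrite -(eqn_add2l m) subnKC.
rewrite (_ : (n == _) = false) ?mulr0n //.
by apply: contraFF mn => /eqP->; rewrite leq_addr.
Qed.

(** Terms with [k > n] vanish, since then [m * k > n]. The free bound [B] allows a shift of [k]
    between two such sums. *)
Lemma EG_monomE A c m B n : (0 < m)%N -> (n < B)%N ->
  EG A (fps_monom c m) n = \sum_(k < B) A k / k`!%:R * c ^+ k *+ (n == (m * k)%N).
Proof.
move=> m0 nB.
rewrite [RHS](eq_bigr (fun k : 'I_B => A k / k`!%:R * fps_exp (fps_monom c m) k n)).
  rewrite /EG (big_ord_widen B (fun k => A k / k`!%:R * fps_exp (fps_monom c m) k n)) //.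
  rewrite big_mkcond; apply: eq_bigr => k _ /=; case: ifP => // /negbT; rewrite -leqNgt.
  move=> nk; rewrite fps_exp_monom /fps_monom (_ : (_ == _) = false) ?mulr0 //.
  by rewrite ltn_eqF // (leq_trans nk) // leq_pmull.
by move=> k _; rewrite fps_exp_monom /fps_monom mulrnAr.
Qed.

(** This moves the exponential factors of the expectations into the variable of [EG]. *)
Lemma EG_scale A c d m : (0 < m)%N ->
  EG (fun k => A k * d ^+ k) (fps_monom c m) = EG A (fps_monom (d * c) m).
Proof.
move=> m0; apply/funext => n; rewrite !(@EG_monomE _ _ _ n.+1) //; apply: eq_bigr => k _.
by congr (_ *+ _); rewrite exprMn mulrA; congr (_ * _); rewrite mulrAC.
Qed.

Lemma EG_monom_0 A c m : (0 < m)%N -> EG A (fps_monom c m) 0 = A 0%N.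
Proof.
move=> m0; rewrite (@EG_monomE _ _ _ 1) // big_ord1 muln0 eqxx fact0 expr0.
by rewrite divr1 mulr1.
Qed.

Lemma EG_monom_lt A c m n : (n < m)%N -> EG A (fps_monom c m) n = A 0%N *+ (n == 0%N).
Proof.
move=> nm; have m0 : (0 < m)%N by apply: leq_ltn_trans nm.
case: n nm => [_|n nm]; first by rewrite EG_monom_0.
rewrite (@EG_monomE _ _ _ n.+2) // big1 // => -[[|k] /= _] _; first by rewrite muln0.
by rewrite ltn_eqF // (leq_trans nm) // leq_pmulr.
Qed.

Lemma fps_prod_cat (a b c : nat) (f : nat -> fps K) : (a <= b <= c)%N ->
  fps_prod a c f = fps_mul (fps_prod a b f) (fps_prod b c f).
Proof. by case/andP=> ab bc; rewrite /fps_prod (@big_cat_nat _ _ _ b). Qed.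

Lemma fps_prod_1 a b (f : nat -> fps K) n :
  (forall m i, (a <= m < b)%N -> (i <= n)%N -> f m i = fps1 K i) ->
  fps_prod a b f n = fps1 K n.
Proof.
move=> f1; suff : forall i, (i <= n)%N -> fps_prod a b f i = fps1 K i by apply.
rewrite /fps_prod big_seq.
apply: (@big_ind _ (fun g : fps K => forall i, (i <= n)%N -> g i = fps1 K i)) => //.
  by move=> g h gE hE i iN; rewrite (@fps_mul_eq _ (fps1 K) _ (fps1 K));
    rewrite ?fps_mul1 // => j jN; rewrite ?gE ?hE // (leq_trans jN).
by move=> m; rewrite mem_index_iota => mI i iN; rewrite f1.
Qed.

(** Each factor with [m >= N] is 1 up to terms of order at least [m > n], because [A m 0 = 1]. *)
Lemma fps_prod_EG_stable a N M (A : nat -> nat -> K) (c : nat -> K) n :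
  (0 < a <= N)%N -> (n < N <= M)%N -> (forall m, (a <= m)%N -> A m 0%N = 1) ->
  fps_prod a M (fun m => EG (A m) (fps_monom (c m) m)) n =
  fps_prod a N (fun m => EG (A m) (fps_monom (c m) m)) n.
Proof.
case/andP=> a0 aN /andP[nN NM] A0; rewrite (@fps_prod_cat _ N) ?aN //.
rewrite -[RHS](congr1 (@^~ n) (Monoid.mulm1 (@fps_mul K) _)).
apply: fps_mul_eq => // i iN; apply: fps_prod_1 => m j /andP[Nm _] ji.
have jm : (j < m)%N by rewrite (leq_ltn_trans (leq_trans ji iN)) // (leq_trans nN).
by rewrite EG_monom_lt // A0 // (leq_trans aN).
Qed.

(* [f |-> (n |-> f n *+ n)] is the derivation [t d/dt]. *)
Lemma fps_prod_leibniz (I : eqType) (r : seq I) (f : I -> fps K) n : uniq r ->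
  (\big[@fps_mul K/@fps1 K]_(i <- r) f i) n *+ n =
  \sum_(i <- r) fps_mul (fun k => f i k *+ k)
    (\big[@fps_mul K/@fps1 K]_(j <- r | j != i) f j) n.
Proof.
have leib g h k : fps_mul g h k *+ k =
    fps_mul (fun k => g k *+ k) h k + fps_mul g (fun k => h k *+ k) k.
  rewrite /fps_mul -sumrMnl -big_split; apply: eq_bigr => i _ /=.
  by rewrite mulrnAl mulrnAr -mulrnDr subnKC // -ltnS.
elim: r n => [|a r IH] n /=.
  by move=> _; rewrite !big_nil /fps1; case: n => [|n]; rewrite ?mulr0n ?mul0rn.
case/andP=> ar ur; rewrite !big_cons leib eqxx /=; congr (_ + _).
  congr fps_mul; rewrite big_seq [RHS]big_seq_cond; apply: eq_bigl => i.
  by apply/esym/andb_idr => ir; apply: contraNneq ar => <-.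
rewrite {1}/fps_mul (eq_bigr _ (fun i _ => congr1 _ (IH _ ur))).
under eq_bigr => i _ do rewrite mulr_sumr.
rewrite exchange_big /= big_seq [RHS]big_seq; apply: eq_bigr => i ir.
rewrite big_cons (_ : a != i); last by apply: contraNneq ar => ->.
by rewrite fps_mulA (fps_mulC _ (f a)) -fps_mulA.
Qed.

End FpsRing.

(** * The common recursion of cycle weights and [EG] products *)

Section CycleIndex.
Variable K : numFieldType.
Implicit Types (A H : nat -> K) (G : nat -> nat -> K).

Let mon m : fps K := fps_monom m%:R^-1 m.

(** For [k > 0], [m k / (k! m^k) = 1 / ((k-1)! m^(k-1))]; the term [k = 0], where [k.-1] is a
    default value, is killed by the factor [m * k]. *)
Lemma EG_mulX A m : (0 < m)%N ->
  EG (fun k => (m * k)%:R * A k.-1) (mon m) = fps_mul (fps_monom 1 m) (EG A (mon m)).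
Proof.
move=> m0; apply/funext => n; rewrite fps_mul_monom mul1r (@EG_monomE _ _ _ _ n.+1) //.
rewrite big_ord_recl /= muln0 mul0r !mul0r mul0rn add0r; case: leqP => [mn|nm].
  rewrite (@EG_monomE _ _ _ _ n) ?ltn_subrL ?m0 ?(leq_trans m0) //.
  apply: eq_bigr => k _; rewrite /= /bump leq0n add1n mulnS -(eqn_add2l m (n - m)) subnKC //.
  congr (_ *+ _); rewrite exprS factS -mulnS !natrM invfM.
  have m'0 : (m%:R : K) != 0 by rewrite pnatr_eq0 -lt0n.
  have k0 : (1 + k%:R : K) != 0 by rewrite nat1r pnatr_eq0.
  have f0 : ((k`!)%:R : K) != 0 by rewrite pnatr_eq0 -lt0n fact_gt0.
  by field; rewrite f0 m'0 k0.
rewrite big1 // => k _; rewrite /= /bump leq0n add1n ltn_eqF //.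
by rewrite (leq_trans nm) // leq_pmulr.
Qed.

(* The coefficientwise form of [t d/dt EG(A, t^m/m) = t^m EG(S A, t^m/m)]. *)
Lemma EG_euler A m n : (0 < m)%N ->
  EG A (mon m) n *+ n = fps_mul (fps_monom 1 m) (EG (fun k => A k.+1) (mon m)) n.
Proof.
move=> m0; rewrite -EG_mulX // !(@EG_monomE _ _ _ _ n.+1) // -sumrMnl.
apply: eq_bigr => -[[|k] /= _] _; first by rewrite muln0 mul0r !mul0r mul0rn -mulrnA; case: n.
case: eqP => [->|_]; last by rewrite !mulr0n mul0rn.
by rewrite !mulr1n -[LHS]mulr_natl !mulrA.
Qed.

Definition upd G m H : nat -> nat -> K := fun i => if i == m then H else G i.

(** The cut-off [N] stays fixed during the recursion. A finite product makes sense for every [G],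
    including updated ones, for which [G m 0 = 1] may fail. *)
Definition EGprod N G : fps K := fps_prod 1 N.+1 (fun m => EG (G m) (mon m)).

Let rest N G m := \big[@fps_mul K/@fps1 K]_(j <- index_iota 1 N.+1 | j != m) EG (G j) (mon j).

Lemma EGprod_upd N G m H : (0 < m <= N)%N ->
  EGprod N (upd G m H) = fps_mul (EG H (mon m)) (rest N G m).
Proof.
move=> mN; rewrite /EGprod /fps_prod (bigD1_seq m) ?iota_uniq ?mem_index_iota //=.
rewrite /upd eqxx; congr fps_mul.
by apply: eq_bigr => j /negPf ->.
Qed.

Lemma EGprodE N G m : (0 < m <= N)%N ->
  EGprod N G = fps_mul (EG (G m) (mon m)) (rest N G m).
Proof.
by move=> mN; rewrite /EGprod /fps_prod (bigD1_seq m) ?iota_uniq ?mem_index_iota.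
Qed.

Lemma EGprod_rec N G n : (n <= N)%N ->
  EGprod N G n *+ n =
  \sum_(1 <= m < n.+1) EGprod N (upd G m (fun k => G m k.+1)) (n - m)%N.
Proof.
move=> nN; rewrite {1}/EGprod {1}/fps_prod fps_prod_leibniz ?iota_uniq //.
(* The Leibniz terms with [n < m <= N] vanish because of the factor [t^m], so the right side is
   padded with zeros up to [N]. *)
rewrite [RHS](big_nat_widen _ _ N.+1) // [RHS]big_mkcond /= [LHS]big_nat [RHS]big_nat.
apply: eq_bigr => m mN; rewrite -/(rest N G m) ltnS.
have m0 : (0 < m)%N by case/andP: mN.
have -> : (fun k => EG (G m) (mon m) k *+ k) =
    fps_mul (fps_monom 1 m) (EG (fun k => G m k.+1) (mon m)).
  by apply/funext => k; rewrite EG_euler.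
by rewrite -fps_mulA -EGprod_upd // fps_mul_monom mul1r.
Qed.

Lemma EGprod_updX N G l n : (0 < l <= N)%N ->
  EGprod N (upd G l (fun k => (l * k)%:R * G l k.-1)) n =
  if (l <= n)%N then EGprod N G (n - l)%N else 0.
Proof.
move=> lN; have l0 : (0 < l)%N by case/andP: lN.
by rewrite EGprod_upd // EG_mulX // -fps_mulA -EGprodE // fps_mul_monom mul1r.
Qed.

Lemma EGprod0 N G : EGprod N G 0 = \prod_(1 <= m < N.+1) G m 0%N.
Proof.
rewrite /EGprod /fps_prod (big_morph (fun f : fps K => f 0%N) (id1 := 1) (op1 := *%R)) //.
  by rewrite !big_nat; apply: eq_bigr => m /andP[m0 _]; rewrite EG_monom_0.
by move=> f g; rewrite /fps_mul big_ord1.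
Qed.

Definition cyc_weight N G n (s : 'S_n) : K := \prod_(1 <= m < N.+1) G m (ncycles m s).

Lemma cyc_weight_ins N G n (s : 'S_n) : (n < N)%N ->
  \sum_(j < n) cyc_weight N G (ins_perm (lift ord0 j) s) =
  \sum_(1 <= l < n.+1) cyc_weight N (upd (upd G l.+1 (fun k => G l.+1 k.+1)) l
                          (fun k => (l * k)%:R * G l k.-1)) s.
Proof.
move=> nN.
(* [g l] is the weight after insertion into a cycle of length [l]; it occurs once for each of the
   [l * ncycles l s] points in such cycles. If there are none, the subtraction truncates but the
   multiplicity is 0. *)
pose g l := \prod_(1 <= m < N.+1) G m (ncycles m s - (m == l) + (m == l.+1))%N.
have cg (j : 'I_n) : cyc_weight N G (ins_perm (lift ord0 j) s) = g #|porbit s j|.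
  apply: eq_bigr => m _; congr (G m _); have := ncycles_ins m s j.
  (* The cycle of [j] is itself counted, so here the subtraction in [g] is exact. *)
  have : ((m == #|porbit s j|) <= ncycles m s)%N.
    case: eqP => //= ->; rewrite card_gt0; apply/set0Pn; exists (porbit s j).
    by rewrite inE eqxx imset_f.
  move=> /subnK E1 E2; apply/eqP; rewrite -(eqn_add2r (m == #|porbit s j|)) E2.
  by rewrite addnAC E1.
rewrite (eq_bigr _ (fun j _ => cg j)).
transitivity (\sum_(1 <= l < n.+1) g l *+ (l * ncycles l s)).
  transitivity (\sum_(j < n) \sum_(1 <= l < n.+1 | l == #|porbit s j|) g l).
    apply: eq_bigr => j _; rewrite big_nat1_eq lt0n card_porbit_neq0 ltnS.
    by rewrite -[X in (_ <= X)%N]card_ord max_card.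
  rewrite (exchange_big_dep xpredT) //=; apply: eq_bigr => l _.
  by rewrite -card_porbit_eq -sumr_const; apply: eq_bigl => j; rewrite !inE eq_sym.
rewrite !big_nat; apply: eq_bigr => l /andP[l0 ln].
have lN : l \in index_iota 1 N.+1.
  by rewrite mem_index_iota l0 ltnS ltnW // (leq_trans ln) // ltnW.
rewrite /g /cyc_weight !(bigD1_seq l lN) ?iota_uniq //= /upd !eqxx.
rewrite -(mulr_natl _ (l * _)) mulrA; congr (_ * _).
  by rewrite ltn_eqF // addn0 subn1.
apply: eq_bigr => m /negPf ml; rewrite ml subn0.
by case: eqP => [->|_]; rewrite ?addn1 ?addn0.
Qed.

Lemma sum_cyc_weight N G n : (n <= N)%N ->
  \sum_(s : 'S_n) cyc_weight N G s = n`!%:R * EGprod N G n.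
Proof.
elim: n G => [|n IH] G nN.
  rewrite EGprod0 mul1r (eq_bigr (fun _ : 'S_0 => \prod_(1 <= m < N.+1) G m 0%N)).
    by rewrite big_const iter_addr addr0 card_Sn.
  move=> s _; rewrite /cyc_weight !big_nat; apply: eq_bigr => m /andP[m0 _].
  by rewrite ncycles_gt.
rewrite sum_ins big_ord_recl exchange_big /=.
have n1 : (0 < N)%N by apply: leq_ltn_trans nN.
have -> : \sum_(s : 'S_n) cyc_weight N G (ins_perm ord0 s) =
    \sum_(s : 'S_n) cyc_weight N (upd G 1 (fun k => G 1%N k.+1)) s.
  apply: eq_bigr => s _; apply: eq_bigr => m _; rewrite ncycles_ins0 /upd.
  by case: eqP => [->|].
rewrite (eq_bigr _ (fun s _ => cyc_weight_ins G s nN)) exchange_big /=.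
(* Write [(n+1)!] as [n! (n+1)] and expand by [EGprod_rec]: the term [m = 1] is the fixed-point
   case, the term [m = l+1] the insertion into cycles of length [l]. *)
rewrite IH ?(ltnW nN) // factS natrM mulrAC (mulr_natl (EGprod N G n.+1)) EGprod_rec //.
rewrite [RHS]mulrC (big_nat_recl n.+1) // subn1 mulrDr; congr (_ + _).
rewrite mulr_sumr big_nat [RHS]big_nat; apply: eq_bigr => l /andP[l0 ln].
rewrite IH ?(ltnW nN) //; congr (_ * _).
(* The update at [l.+1] leaves [G l] alone; reading it in the updated family gives the form that
   [EGprod_updX] expects. *)
have -> : G l = upd G l.+1 (fun k => G l.+1 k.+1) l by rewrite /upd ltn_eqF.
have {}ln : (l <= n)%N by rewrite -ltnS.
by rewrite EGprod_updX ?ln ?subSS // l0 (leq_trans ln) // ltnW.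
Qed.

End CycleIndex.

(** * The complex exponential as a homomorphism *)

Section ComplexExp.
Variable R : realType.
Implicit Types z w : R[i].

Lemma cexp0 : cexp (0 : R[i]) = 1.
Proof. by rewrite /cexp /= expR0 cos0 sin0 mul1r. Qed.

Lemma cexpD z w : cexp (z + w) = cexp z * cexp w.
Proof.
case: z w => [a b] [c d]; rewrite /cexp /= expRD cosD sinD rmorphM /=.
rewrite mulrACA; congr (_ * _); apply/eqP; rewrite eq_complex /=.
by rewrite eqxx [X in _ == X]addrC eqxx.
Qed.

Lemma cexpMn z k : cexp (z * k%:R) = cexp z ^+ k.
Proof.
elim: k => [|k IH]; first by rewrite mulr0 cexp0.
by rewrite mulrSr mulrDr mulr1 cexpD IH exprSr.
Qed.

Lemma cexp_sum (I : Type) (r : seq I) (f : I -> R[i]) :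
  cexp (\sum_(i <- r) f i) = \prod_(i <- r) cexp (f i).
Proof. exact: (big_morph _ cexpD cexp0). Qed.

End ComplexExp.

(** * Generating series of the weighted measure *)

Section WeightedMeasureSeries.
Variables (R : realType) (F : nat -> nat -> R).
Hypothesis Fpos : forall m k : nat, (1 <= m)%N -> 0 < F m k.
Hypothesis F0 : forall m : nat, (1 <= m)%N -> F m 0%N = 1.

Lemma weight_gt0 n (s : 'S_n) : 0 < weight F s.
Proof. by rewrite /weight big_nat prodr_gt0 // => m /andP[m0 _]; rewrite Fpos. Qed.

Lemma h_gt0 n : 0 < h F n.
Proof.
rewrite /h mulr_gt0 ?invr_gt0 ?ltr0n ?fact_gt0 // (bigD1 1%g) //=.
by rewrite ltr_pwDl ?weight_gt0 // sumr_ge0 // => s _; rewrite ltW ?weight_gt0.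
Qed.

Lemma weight_widen n N (s : 'S_n) : (n <= N)%N ->
  weight F s = \prod_(1 <= m < N.+1) F m (ncycles m s).
Proof.
move=> nN; rewrite (@big_cat_nat _ _ _ n.+1) //= [X in _ * X]big_nat [X in _ * X]big1 ?mulr1 //.
by move=> m /andP[nm _]; rewrite ncycles_gt // F0 // (leq_ltn_trans _ nm).
Qed.

(** Positivity of [F] makes [h F n] nonzero, so the normalization cancels. *)
Lemma h_EF n (X : 'S_n -> R[i]) :
  (h F n)%:C * EF F X = (n`!%:R)^-1 * \sum_(s : 'S_n) (weight F s)%:C * X s.
Proof.
rewrite /EF !mulr_sumr; apply: eq_bigr => s _; rewrite !mulrA; congr (_ * _).
rewrite /PF -rmorphM invfM mulrA mulrCA mulfV ?gt_eqF ?h_gt0 // mulr1.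
by rewrite rmorphM fmorphV rmorph_nat.
Qed.

Lemma h_EF1 n : (h F n)%:C * EF F (fun _ : 'S_n => 1) = (h F n)%:C.
Proof.
rewrite h_EF /h rmorphM fmorphV rmorph_nat rmorph_sum.
by congr (_ * _); apply: eq_bigr => s _; rewrite mulr1.
Qed.

(** For [X] multiplicative in the cycle counts, weight times [X] is again a cycle weight. As any
    [N >= n] is allowed, the formula holds for every long enough partial product. *)
Lemma h_EF_series (u : nat -> R[i]) n N (X : 'S_n -> R[i]) : (n <= N)%N ->
  (forall s, X s = \prod_(1 <= m < N.+1) u m ^+ ncycles m s) ->
  (h F n)%:C * EF F X =
  fps_prod 1 N.+1 (fun m => EG (fun k => (F m k)%:C) (fps_monom (u m / m%:R) m)) n.
Proof.
move=> nN XE; rewrite h_EF.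
have -> : \sum_(s : 'S_n) (weight F s)%:C * X s =
    \sum_(s : 'S_n) cyc_weight N (fun m k => (F m k)%:C * u m ^+ k) s.
  apply: eq_bigr => s _; rewrite XE (weight_widen _ nN) rmorph_prod -big_split.
  by [].
rewrite sum_cyc_weight // mulrA mulVf ?mul1r; last first.
  by rewrite pnatr_eq0 -lt0n fact_gt0.
congr (_ n); rewrite /EGprod /fps_prod !big_nat; apply: eq_bigr => m /andP[m0 _].
exact: EG_scale.
Qed.

End WeightedMeasureSeries.

Theorem theorem6p3 (R : realType) (F : nat -> nat -> R)
    (Fpos : forall m k : nat, (1 <= m)%N -> 0 < F m k)
    (F0 : forall m : nat, (1 <= m)%N -> F m 0%N = 1) :
  [/\ fps_infprod 1
        (fun m => EG (fun k => (F m k)%:C) (fps_monom (m%:R^-1 : R[i]) m))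
        (fun n => (h F n)%:C),
      forall (b : nat) (s : nat -> R),
        exists2 P : fps R[i],
          fps_infprod b.+1
            (fun m => EG (fun k => (F m k)%:C) (fps_monom (m%:R^-1 : R[i]) m))
            P
          & (fun n => (h F n)%:C *
               EF F (fun sigma : 'S_n =>
                 cexp ('i%C * (\sum_(1 <= m < b.+1)
                               s m * (ncycles m sigma)%:R)%:C)))
            =1 fps_mul
                 (fps_prod 1 b.+1 (fun m => EG (fun k => (F m k)%:C)
                    (fps_monom (cexp ('i%C * (s m)%:C) / m%:R) m)))
                 P
    & forall w : R[i],
        fps_infprod 1
          (fun m => EG (fun k => (F m k)%:C) (fps_monom (cexp w / m%:R) m))
          (fun n => (h F n)%:C *
             EF F (fun sigma : 'S_n => cexp (w * (K0 sigma)%:R)))].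
Proof.
have FC0 a m : (a < m)%N -> (F m 0%N)%:C = 1 by move=> am; rewrite F0 // (leq_ltn_trans _ am).
split=> [|b s|w].
(* Take [u = 1]: every partial product including all [m <= n] already has the exact coefficient. *)
- move=> n; exists n.+1 => -[//|M] nM; rewrite -h_EF1 //.
  rewrite (h_EF_series Fpos F0 (u := fun=> 1) (ltnSE nM)).
    by congr (_ n); apply: eq_bigr => m _; rewrite mul1r.
  by move=> sigma; rewrite big1 // => m _; rewrite expr1n.
- set f := fun m => EG _ (fps_monom m%:R^-1 m).
  have stab i N : (maxn b i < N)%N -> fps_prod b.+1 N f i = fps_prod b.+1 (maxn b i).+1 f i.
    move=> iN; apply: fps_prod_EG_stable; last exact: FC0.
      by rewrite /= ltnS leq_maxl.
    by rewrite ltnS leq_maxr.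
  (* Coefficient [i] of the limit is read off where it has become constant; the maximum with [b]
     keeps the range from ending before it starts. *)
  exists (fun i => fps_prod b.+1 (maxn b i).+1 f i).
    by move=> n; exists (maxn b n).+1 => M; apply: stab.
  move=> n; pose u m := if (m <= b)%N then cexp ('i%C * (s m)%:C) else 1.
  have bN : (0 < b.+1 <= (maxn b n).+1)%N by rewrite /= ltnS leq_maxl.
  rewrite (h_EF_series Fpos F0 (u := u) (N := maxn b n)) ?leq_maxr //; last first.
    move=> sigma; rewrite [RHS](@big_cat_nat _ _ _ b.+1) //= [X in _ = _ * X]big_nat.
    rewrite [X in _ = _ * X]big1 ?mulr1; last first.
      by move=> m /andP[bm _]; rewrite /u leqNgt bm expr1n.
    rewrite rmorph_sum mulr_sumr cexp_sum !big_nat; apply: eq_bigr => m /andP[_ mb].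
    by rewrite /u -ltnS mb -cexpMn rmorphM rmorph_nat mulrA.
  rewrite (fps_prod_cat _ bN); apply: fps_mul_eq => i iN.
    congr (_ i); rewrite /fps_prod !big_nat; apply: eq_bigr => m /andP[_ mb].
    by rewrite /u -ltnS mb.
  (* Stability replaces the cut-off of [P], which varies with [i], by the common one. *)
  rewrite -(@stab _ (maxn b n).+1); last first.
    by rewrite ltnS geq_max leq_maxl (leq_trans iN) // leq_maxr.
  congr (_ i); rewrite /fps_prod !big_nat; apply: eq_bigr => m /andP[bm _].
  by rewrite /u leqNgt bm mul1r.
- move=> n; exists n.+1 => -[//|M] nM; rewrite (h_EF_series Fpos F0 (u := fun=> cexp w) (ltnSE nM)) //.
  (* No cycle is longer than [n], so summing the counts up to [M] still gives [K0]. *)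
  move=> sigma; rewrite cexpMn -expr_sum; congr (_ ^+ _).
  rewrite /K0 [RHS](@big_cat_nat _ _ _ n.+1) //= [X in (_ + X)%N]big_nat.
  by rewrite [X in (_ + X)%N]big1 ?addn0 // => m /andP[nm _]; rewrite ncycles_gt.
Qed.
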